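(* Let $Z\times T$ be compact, and let $g(z,t)$ be continuous on $Z\times T$. Suppose we have an oracle that generates an optimal solution of the problem $\min_{z\in Z}\{f(z):\ g(z,t)\le 0,\ t\in T'\}$ for any finite set $T'\subseteq T$, and an oracle that generates an $\varepsilon$-optimal solution of the problem $\max_{t\in T}g(z,t)$ for any $z\in Z$ and $\varepsilon>0$. Then the modified exchange algorithm (described in the context), run with tolerance $\varepsilon>0$, returns an $\varepsilon$-optimal solution of (gen-SIP) in finitely many iterations.
   Context: (gen-SIP) is the general semi-infinite program $$\min_{z}\ f(z)\quad\text{s.t.}\quad g(z,t)\le 0\ \ \forall t\in T,\qquad z\in Z,$$ where $Z\subseteq\mathbb{R}^{k_1}$ and $T\subseteq\mathbb{R}^{k_2}\times\mathbb{Z}^{k_3}$, $f:Z\to\mathbb{R}$, $g:Z\times T\to\mathbb{R}$. Let $\mathrm{val}$ denote its optimal value. A point $z_0\in Z$ is an $\varepsilon$-feasible solution of (gen-SIP) if $\max_{t\in T}g(z_0,t)\le\varepsilon$. A point $z_0\in Z$ is an $\varepsilon$-optimal solution of (gen-SIP) if it is $\varepsilon$-feasible and $f(z_0)\le\mathrm{val}$. For the maximization problem $\max_{t\in T}g(z,t)$, a $\delta$-optimal solution is a point $t'\in T$ with $\max_{t\in T}g(z,t)\le g(z,t')+\delta$. Modified exchange algorithm (tolerance $\varepsilon>0$): Step 1. Set $T_0\leftarrow\emptyset$, $k\leftarrow0$. Step 2. Using the first oracle, determine an optimal solution $z_k$ of $\min_{z\in Z}\{f(z):\ g(z,t)\le0,\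 t\in T_k\}$. Step 3. Using the second oracle, determine an $\frac{\varepsilon}{2}$-optimal solution $t_{k+1}$ of $\max_{t\in T}g(z_k,t)$. If $g(z_k,t_{k+1})\le\frac{\varepsilon}{2}$, stop and return $z_k$; otherwise let $T_{k+1}\leftarrow T_k\cup\{t_{k+1}\}$, $k\leftarrow k+1$, and go to Step 2. *)

(* Defs.v *)
From HB Require Import structures.
From mathcomp Require Import all_boot all_order all_algebra.
From mathcomp Require Import all_classical all_reals all_analysis.

Set Implicit Arguments.
Unset Strict Implicit.
Unset Printing Implicit Defensive.

Import Order.TTheory GRing.Theory Num.Theory.
Import numFieldNormedType.Exports.

Local Open Scope classical_set_scope.
Local Open Scope ring_scope.

(* MathComp-Analysis puts no topology on [int]; the discrete one is the
   topology of Z as a subspace of the real line. *)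
HB.instance Definition _ := hasNbhs.Build int principal_filter.
HB.instance Definition _ := Discrete_ofNbhs.Build int erefl.

Section semi_infinite_program.
Context {R : realType} {X Y : Type}.
(* [f] and [g] are total; only their values on [Z] and [Z `*` T] are used. *)
Implicit Types (Z : set X) (T : set Y) (f : X -> R) (g : X -> Y -> R).

Definition sip_feasible Z g T : set X :=
  [set z | Z z /\ forall t, T t -> g z t <= 0].

(* +oo when there is no feasible point. *)
Definition sip_val Z T f g : \bar R :=
  ereal_inf [set (f z)%:E | z in sip_feasible Z g T].

(* A supremum in the extended reals; it is the maximum whenever that is
   attained, in particular when [T] is compact and nonempty and [g z] is
   continuous on [T]. *)
Definition max_constraint T g (z : X) : \bar R :=
  ereal_sup [set (g z t)%:E | t in T].

Definition eps_feasible Z T g (eps : R) (z0 : X) : Prop :=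
  Z z0 /\ (max_constraint T g z0 <= eps%:E)%E.

(* The comparison is with the value of the original program, not with that of
   its eps-relaxation, and has no slack in the objective. *)
Definition eps_optimal Z T f g (eps : R) (z0 : X) : Prop :=
  eps_feasible Z T g eps z0 /\ ((f z0)%:E <= sip_val Z T f g)%E.

Definition optimal_solution Z f g (T' : set Y) (z0 : X) : Prop :=
  sip_feasible Z g T' z0 /\ forall z, sip_feasible Z g T' z -> f z0 <= f z.

Definition delta_optimal_max T g (z : X) (delta : R) (t' : Y) : Prop :=
  T t' /\ (max_constraint T g z <= (g z t' + delta)%:E)%E.

Definition is_min_oracle Z T f g (oracle1 : set Y -> X) : Prop :=
  forall T' : set Y, T' `<=` T -> finite_set T' ->
    optimal_solution Z f g T' (oracle1 T').

Definition is_max_oracle Z T g (oracle2 : X -> R -> Y) : Prop :=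
  forall (z : X) (delta : R), Z z -> 0 < delta ->
    delta_optimal_max T g z delta (oracle2 z delta).

(* [Running Tk]: about to enter Step 2 with current finite set [Tk];
   [Returned z]: stopped with output [z]. *)
Inductive exchange_state : Type :=
| Running of set Y
| Returned of X.

(* One pass through Steps 2 and 3. *)
Definition exchange_step g (oracle1 : set Y -> X) (oracle2 : X -> R -> Y)
    (eps : R) (s : exchange_state) : exchange_state :=
  match s with
  | Running Tk =>
      let z := oracle1 Tk in
      let t := oracle2 z (eps / 2) in
      if g z t <= eps / 2 then Returned z else Running (Tk `|` [set t])
  | Returned z => Returned z
  end.

Definition modified_exchange g oracle1 oracle2 (eps : R) (n : nat) :
    exchange_state :=
  iter n (exchange_step g oracle1 oracle2 eps) (Running set0).

End semi_infinite_program.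

(* Main.v *)
(** Put [z_k] for the point and [t_k] for the constraint index produced in
    round [k] (Step 3 names the latter [t_(k+1)]). If no round stops, then
    [g z_k t_k > eps / 2] for all [k], while [g z_k t_j <= 0] for [j < k]. Near
    a cluster point of [(z_k, t_k)] in [Z * T], [g] oscillates by less than
    [eps / 2] on a product neighbourhood; two rounds [j < k] landing there put
    both [(z_k, t_j)] and [(z_k, t_k)] in it, a contradiction. When round [k]
    stops, [g z_k t <= eps / 2 + eps / 2] on [T] by the choice of [t_k], and
    [f z_k <= val] because round [k] solves a relaxation. *)

Require Import Defs.
From mathcomp Require Import all_boot all_order all_algebra.
From mathcomp Require Import all_classical all_reals all_analysis.
From mathcomp Require Import lra.

Import Order.TTheory GRing.Theory Num.Theory.
Import numFieldNormedType.Exports.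

Local Open Scope classical_set_scope.
Local Open Scope ring_scope.

Lemma exchange_sequence_stops (R : realType) (X Y : topologicalType)
    (Z : set X) (T : set Y) (g : X -> Y -> R) (z : nat -> X) (t : nat -> Y)
    (c : R) :
  compact (Z `*` T) ->
  {within Z `*` T, continuous (fun zt => g zt.1 zt.2)} ->
  (forall n, Z (z n)) -> (forall n, T (t n)) ->
  (forall j k, (j < k)%N -> g (z k) (t j) <= 0) ->
  0 < c -> exists n, g (z n) (t n) <= c.
Proof.
move=> cZT gcont Zz Tt gle0 c0; apply: contrapT => /forallNP gtc.
have {}gtc n : c < g (z n) (t n) by rewrite ltNge; apply/negP/gtc.
(* A cluster point of this filter stands in for the limit of a subsequence, since [X] and [Y] are
   arbitrary topological spaces. *)
pose F := (fun k => (z k, t k)) @ \oo.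
have FZT : F (Z `*` T) by exists 0%N => // k _; split; [exact: Zz | exact: Tt].
have [[zs ts] [[/= Zzs Tts] clF]] := cZT F _ FZT.
move/subspace_continuousP : gcont => /(_ (zs, ts) (conj Zzs Tts)).
(* With radius [c / 2], any two values of [g] near the cluster point differ by less than [c]. *)
move=> /cvgrPdist_lt /(_ (c / 2)); rewrite divr_gt0// => /(_ isT).
rewrite near_withinE /= => -[[U V] /= [nU nV] UVg].
have visit N : exists2 k, (N <= k)%N & U (z k) /\ V (t k).
  have FN : F [set (z k, t k) | k in [set k | (N <= k)%N]].
    by exists N => // k Nk; exists k.
  have [|_ [[k /= Nk <-] [Uz Vt]]] := clF _ (U `*` V) FN.
    by exists (U, V).
  by exists k.
have [j _ [_ Vtj]] := visit 0%N.
(* Starting at [j.+1] makes [j < k] strict, so that [gle0] applies to [(z k, t j)]. *)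
have [k jk [Uzk Vtk]] := visit j.+1.
have := UVg (z k, t j) (conj Uzk Vtj) (conj (Zz k) (Tt j)).
have := UVg (z k, t k) (conj Uzk Vtk) (conj (Zz k) (Tt k)).
rewrite /from_subspace /= !ltr_distlC; have := gle0 _ _ jk; have := gtc k.
by move=> ? ? /andP[? ?] /andP[? ?]; lra.
Qed.

Theorem theorem4p2 (R : realType) (k1 k2 k3 : nat)
    (Z : set 'rV[R]_k1) (T : set ('rV[R]_k2 * 'rV[int]_k3)%type)
    (f : 'rV[R]_k1 -> R) (g : 'rV[R]_k1 -> 'rV[R]_k2 * 'rV[int]_k3 -> R)
    (oracle1 : set ('rV[R]_k2 * 'rV[int]_k3)%type -> 'rV[R]_k1)
    (oracle2 : 'rV[R]_k1 -> R -> 'rV[R]_k2 * 'rV[int]_k3)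
    (eps : R) :
  compact (Z `*` T) ->
  {within Z `*` T, continuous (fun zt => g zt.1 zt.2)} ->
  is_min_oracle Z T f g oracle1 ->
  is_max_oracle Z T g oracle2 ->
  0 < eps ->
  exists (n : nat) (z0 : 'rV[R]_k1),
    modified_exchange g oracle1 oracle2 eps n = Returned z0 /\
    eps_optimal Z T f g eps z0.
Proof.
move=> cZT gcont min1 max2 eps0.
have eps20 : 0 < eps / 2 by rewrite divr_gt0.
pose t S := oracle2 (oracle1 S) (eps / 2).
(* The run with the stopping test removed, hence defined for every [n]; it agrees with the algorithm
   up to the first stop. *)
pose Tk n := iter n (fun S => S `|` [set t S]) set0.
(* Both claims go in one induction: [oracle1] is trusted only on finite subsets of [T], and
   [oracle2] only at points of [Z]. *)
have TkP n : Tk n `<=` T /\ finite_set (Tk n).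
  elim: n => [|n [TkT fin]]; first by split; [exact: sub0set | exact: finite_set0].
  have [[Zz _] _] := min1 _ TkT fin.
  have [Tt _] := max2 _ _ Zz eps20.
  split; last by rewrite /= finite_setU.
  by rewrite /= subUset; split=> // _ ->.
have optz n : optimal_solution Z f g (Tk n) (oracle1 (Tk n)).
  by have [] := TkP n; exact: min1.
have Zz n : Z (oracle1 (Tk n)) by have [[]] := optz n.
have optt n := max2 _ _ (Zz n) eps20.
have memTk j k : (j < k)%N -> Tk k (t (Tk j)).
  elim: k => // k IH; rewrite ltnS leq_eqVlt => /predU1P[->|/IH]; first by right.
  by left.
have stop : exists n, g (oracle1 (Tk n)) (t (Tk n)) <= eps / 2.
  apply: (exchange_sequence_stops _ _ _ _ _ _ (fun n => oracle1 (Tk n))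
    (fun n => t (Tk n)) _ cZT gcont) => // [n|j k jk].
    by have [] := optt n.
  by have [[_ +] _] := optz k; apply; exact: memTk.
(* The least such [n], so that no earlier round stops. *)
case: (ex_minnP stop) => n gn nmin.
have run m : (m <= n)%N ->
    modified_exchange g oracle1 oracle2 eps m = Running (Tk m).
  elim: m => // m IH mn; rewrite /modified_exchange iterS.
  rewrite -/(modified_exchange _ _ _ _ _) IH ?(ltnW mn)//=.
  by case: ifPn => // /nmin; rewrite leqNgt mn.
(* [n] steps reach [Running (Tk n)]; one more performs the test and returns. *)
exists n.+1, (oracle1 (Tk n)); split.
  rewrite /modified_exchange iterS -/(modified_exchange _ _ _ _ _) run//=.
  by rewrite gn.
split.
  split=> //; have [_ /le_trans] := optt n; apply.
  by rewrite lee_fin [leRHS]splitr lerD2r.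
apply: le_ereal_inf_tmp => _ [z [Zz' gz] <-]; rewrite lee_fin.
have [_] := optz n; apply; split=> // s Tks; apply: gz.
by have [TkT _] := TkP n; exact: TkT.
Qed.
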